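(* Assume $\mathfrak b=\mathfrak d$. The universal preuniformity $p\mathcal U_X$ of a topological space $X$ has an $\omega^\omega$-base if and only if $X$ has an $\omega^\omega$-base, $|X'|<\mathfrak b=\mathfrak d$ and $|X^{\prime P}|\le\omega$.
   Context: $\omega^\omega$ carries the coordinatewise order. $\mathfrak d$ is the smallest cardinality of a cofinal subset of $(\omega^\omega,\le)$; $\mathfrak b$ is the smallest cardinality of an unbounded subset of $(\omega^\omega,\le^* )$, where $f\le^*g$ iff $f(n)\le g(n)$ for all but finitely many $n$. No separation axioms are assumed on $X$; neighborhoods need not be open. The universal preuniformity $p\mathcal U_X$ is the family of all neighborhood assignments on $X$, i.e. of all sets $U\subset X\times X$ such that for every $x\in X$ the set $U[x]=\{y:(x,y)\in U\}$ is a neighborhood of $x$. It has an $\omega^\omega$-base if there is a family $(U_\alpha)_{\alpha\in\omega^\omega}$ in $p\mathcal U_X$ with $U_\beta\subset U_\alpha$ for all $\alpha\le\beta$ such that each $U\in p\mathcal U_X$ contains some $U_\alpha$. The space $X$ has an $\omega^\omega$-base if each point $x\in X$ has a neighborhood base $(V_\alpha)_{\alpha\in\omega^\omega}$ with $V_\beta\subset V_\alpha$ for all $\alpha\le\beta$. A point $x\in X$ is singular if the intersection of all neighborhoods of $x$ is a neighborhood of $x$; $X'$ is the set of non-singular points. A point $x$ is a $P$-point if the intersection of any countably many neighborhoods of $x$ is a neighborhood of $x$; $X^{\prime P}$ is the set of points of $X$ that are not $P$-points. *)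

(* Defs.v *)
From mathcomp Require Import all_boot all_order.
From mathcomp Require Import all_classical all_analysis.

Set Implicit Arguments.
Unset Strict Implicit.
Unset Printing Implicit Defensive.

Import Order.TTheory.

Local Open Scope classical_set_scope.
Local Open Scope card_scope.
Local Open Scope nat_scope.

(* [(f <= g)%O] on a function type is the library's pointwise order (lefP). *)
Notation baire := (nat -> nat).

Definition le_star (f g : baire) : Prop := \forall n \near \oo, f n <= g n.

Definition cofinal (D : set baire) : Prop :=
  forall f, exists2 g, D g & (f <= g)%O.

Definition unbounded_star (B : set baire) : Prop :=
  ~ exists g, forall f, B f -> le_star f g.

Definition card_lt T U (A : set T) (B : set U) : Prop :=
  A #<= B /\ ~ (B #<= A).

(* A cardinal is represented by a set of that cardinality, and is only ever
   used through [#<=], [#=] and [card_lt]. *)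
Definition has_least_card T (P : set (set T)) (A : set T) : Prop :=
  P A /\ forall B, P B -> A #<= B.

(* The default value [set0] is never used: see frak_bP and frak_dP. *)
Definition frak_b : set baire := xget set0 (has_least_card unbounded_star).
Definition frak_d : set baire := xget set0 (has_least_card cofinal).

(* The class of cardinals is well ordered: by Zorn's lemma, take a maximal set F
   of choice functions for the family P such that distinct elements of F differ
   at every member of P; then evaluation at some A in P maps F onto A. *)
Lemma ex_least_card (T : pointedType) (P : set (set T)) :
  P !=set0 -> exists A, has_least_card P A.
Proof.
move=> [A0 PA0].
pose Q (F : set (set T -> T)) :=
  (forall f A, F f -> P A -> A (f A)) /\
  (forall f g A, F f -> F g -> P A -> f A = g A -> f = g).
have [|F [[F1 F2] Fmax]] := @Zorn_bigcup _ Q.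
  move=> G GQ Gtot; split=> [f A [F GF Ff] PA|f g A [F GF Ff] [H GH Hg] PA fg].
    exact: ((GQ _ GF).1 f A Ff PA).
  have [FH|HF] := Gtot _ _ GF GH.
    by apply: ((GQ _ GH).2 _ _ _ (FH _ Ff) Hg PA fg).
  by apply: ((GQ _ GF).2 _ _ _ Ff (HF _ Hg) PA fg).
have [A [PA AF]] : exists A, P A /\ A `<=` (fun f => f A) @` F.
  apply: contrapT => noA.
  have /choice[g gP] : forall A, exists x, P A ->
      A x /\ ~ ((fun f => f A) @` F) x.
    move=> A; have [PA|nPA] := pselect (P A); last by exists point.
    apply: contrapT => nx; apply: noA; exists A; split=> // x Ax.
    by apply: contrapT => nFx; apply: nx; exists x.
  apply: (Fmax (F `|` [set g])).
    split; first by move=> x; left.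
    move=> /(_ g (or_intror erefl)) Fg.
    by case: ((gP _ PA0).2); exists g.
  split=> [f A [Ff|->] PA|f h A [Ff|->] [Fh|->] PA fh].
  - exact: (F1 f A Ff PA).
  - by have [] := gP _ PA.
  - exact: (F2 _ _ A Ff Fh PA fh).
  - by case: ((gP _ PA).2); exists f.
  - by case: ((gP _ PA).2); exists h.
  - by [].
exists A; split=> // B PB.
apply: (card_le_trans (subset_card_le AF)).
apply: (card_le_trans (card_image_le _ _)).
have Finj : {in F &, injective (fun f => f B)}.
  by move=> f g /set_mem Ff /set_mem Fg; exact: (F2 _ _ B).
rewrite -(card_le_eql (inj_card_eq Finj)).
apply: subset_card_le => _ [f Ff <-]; exact: (F1 f B Ff PB).
Qed.

Lemma frak_bP : has_least_card unbounded_star frak_b.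
Proof.
apply: xgetPex; apply: ex_least_card; exists setT => -[g gP].
have [n /= ] := filter_ex (gP (fun n => (g n).+1) I).
by rewrite ltnn.
Qed.

Lemma frak_dP : has_least_card cofinal frak_d.
Proof. by apply: xgetPex; apply: ex_least_card; exists setT => f; exists f. Qed.

(* An antitone family indexed by baire, with values in F and coinitial in F;
   for F = nbhs x this is a neighborhood base at x. *)
Definition has_baire_base T (F : set (set T)) : Prop :=
  exists V : baire -> set T,
    [/\ forall a, F (V a),
        forall a b, (a <= b)%O -> V b `<=` V a &
        forall W, F W -> exists a, V a `<=` W].

Definition universal_preuniformity (X : topologicalType) : set (set (X * X)) :=
  [set U | forall x, nbhs x (xsection U x)].

Definition space_has_baire_base (X : topologicalType) : Prop :=
  forall x : X, has_baire_base (nbhs x).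

Definition singular_point (X : topologicalType) (x : X) : Prop :=
  nbhs x (\bigcap_(V in nbhs x) V).

Definition nonsingular (X : topologicalType) : set X :=
  [set x | ~ singular_point x].

Definition P_point (X : topologicalType) (x : X) : Prop :=
  forall F : set (set X), countable F -> F `<=` nbhs x ->
    nbhs x (\bigcap_(V in F) V).

Definition non_P_points (X : topologicalType) : set X :=
  [set x | ~ P_point x].

Arguments universal_preuniformity X _ : clear implicits.
Arguments nonsingular X _ : clear implicits.
Arguments non_P_points X _ : clear implicits.

(* Main.v *)
Require Import Defs.
From mathcomp Require Import all_boot all_order.
From mathcomp Require Import all_classical all_analysis.

Local Open Scope classical_set_scope.
Local Open Scope card_scope.

(** A base indexed by [baire] for the neighborhood assignments amounts to an
    antitone family [V a x] of neighborhoods such that every choice [N x] of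
    neighborhoods is refined, at all points at once, by some [V a].

    Necessity. Fixing [x] gives a base at [x]. If [frak_d] embedded into the set
    of non-singular points, one could diagonalize: let [a] range over a cofinal
    set of size [frak_d] and attach to it a non-singular point [x_a]; some
    neighborhood [N x_a] does not contain [V a x_a], yet [N] is refined by some
    [V b], and a member [a >= b] of the cofinal set gives a contradiction. As
    cardinals are comparable and [frak_b] equals [frak_d], there are fewer than
    [frak_b] non-singular points.

    Suppose there were uncountably many points [x] that are not P-points, and
    give each a sequence [F x n] of neighborhoods whose intersection is not
    a neighborhood. For a finite sequence [s] of length [n], let [B s] be the set
    of those [x] such that no [b] extending [s] satisfies [V b x `<=` F x n]. For
    each [a], every such point lies in [B s] for some initial segment [s] of [a]
    (cylinder_avoid), so one of these countably many sets is infinite. Only countably many [s] exist, hence distinct points [x_s] of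
    [B s] can be selected for all [s] with [B s] infinite
    (distinct_representatives). The assignment with value [F x_s (size s)] at
    [x_s] is then refined by no [V a].

    Sufficiency. At a singular point the least neighborhood serves for every
    index. At a P-point, a base can be made antitone for eventual domination
    (P_point_star_base), so that the indices required at fewer than [frak_b]
    points are all dominated by a single one. The remaining points are
    countable in number and each receives its own index: countably many
    elements of [baire] are coded by one through a pairing on [nat]. *)

(** * Cardinality *)

(** The family made of disjoint copies of [A] and [B] has a member of least
    cardinality. *)
Lemma card_le_total T U (A : set T) (B : set U) : A #<= B \/ B #<= A.
Proof.
(* The copies are sets of singletons because [ex_least_card] asks for a pointed
   type, which [T + U] need not be. *)
pose W : pointedType := set (T + U)%type.
pose A' : set W := (fun x => [set inl x]) @` A.
pose B' : set W := (fun y => [set inr y]) @` B.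
have cA : A' #= A by apply: inj_card_eq => x y _ _ /seteqP[/(_ _ erefl)[->]].
have cB : B' #= B by apply: inj_card_eq => x y _ _ /seteqP[/(_ _ erefl)[->]].
have [|C [+ leC]] := @ex_least_card W [set A'; B']; first by exists A'; left.
case=> CE; [left|right].
  by rewrite -(card_le_eql cA) -(card_le_eqr cB) -CE; apply: leC; right.
by rewrite -(card_le_eql cB) -(card_le_eqr cA) -CE; apply: leC; left.
Qed.

(** Choose the representatives one index at a time: only finitely many values
    have been used before a given index, so an infinite set still has a new
    element. *)
Lemma distinct_representatives (I : countType) T (A : I -> set T) :
  (forall i, infinite_set (A i)) ->
  exists2 f : I -> T, injective f & forall i, A i (f i).
Proof.
move=> Ainf.
have /choice[g gP] : forall p : set T * I, exists x,
    finite_set p.1 -> A p.2 x /\ ~ p.1 x.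
  move=> [B i] /=; have [finB|] := pselect (finite_set B).
    have /infinite_setN0[x [Ax nBx]] := infinite_setD (Ainf i) finB.
    by exists x.
  by have /infinite_setN0[x _] := Ainf i; exists x.
pose fix used n : set T := if n is m.+1 then
  used m `|` (if unpickle m is Some i then [set g (used m, i)] else set0)
  else set0.
have used_fin n : finite_set (used n).
  by elim: n => //= n IH; rewrite finite_setU; split=> //; case: unpickle.
have used_sub m n : (m <= n)%N -> used m `<=` used n.
  elim: n => [|n IH]; first by rewrite leqn0 => /eqP ->.
  rewrite leq_eqVlt => /predU1P[-> //|/IH mn x /mn ?]; by left.
pose f i := g (used (pickle i), i).
have fA i : A i (f i) by case: (gP (used (pickle i), i) (used_fin _)).
have f_new i j : (pickle i < pickle j)%N -> f i <> f j.
  move=> /used_sub ij fij.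
  case: (gP (used (pickle j), j) (used_fin _)) => _; apply.
  by apply: ij => /=; right; rewrite pickleK -/(f j) -fij.
exists f => // i j fij; apply: (pcan_inj pickleK).
by case: (ltngtP (pickle i) (pickle j)) => // /f_new; [|move/nesym].
Qed.

(** * The order of eventual domination *)

(** The finitely many exceptions to [f n <= g n] are absorbed by a constant.
    Replacing finite modifications by the constant shifts of a function leaves
    only countably many variants to intersect in [P_point_star_base]. *)
Lemma le_star_shift (f g : baire) :
  le_star f g -> exists K, (f <= (fun n => g n + K)%N)%O.
Proof.
move=> [N _ fg]; exists (\sum_(n < N) f n)%N; apply/lefP => n; rewrite leEnat.
have [nN|Nn] := ltnP n N; last by rewrite (leq_trans (fg n Nn)) ?leq_addr.
by rewrite (bigD1 (Ordinal nN)) //= addnCA leq_addr.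
Qed.

Lemma le_star_bounded T (A : set T) (a : T -> baire) :
  ~ (frak_b #<= A) -> exists g, forall x, A x -> le_star (a x) g.
Proof.
move=> nbA; apply: contrapT => unb; apply: nbA.
apply: card_le_trans (card_image_le a A); apply: frak_bP.2 => -[g gP].
by apply: unb; exists g => x Ax; apply: gP; exists x.
Qed.

(** * Coding sequences and cylinders *)

Definition slice (a : baire) (n : nat) : baire :=
  fun k : nat => a (pickle (n, k)).

Lemma slice_le (a b : baire) n : (a <= b)%O -> (slice a n <= slice b n)%O.
Proof. by move=> /lefP ab; apply/lefP => k; exact: ab. Qed.

Lemma slice_surj (c : nat -> baire) : exists a, forall n, slice a n = c n.
Proof.
exists (fun m => if unpickle m is Some (n, k) then c n k else 0%N) => n.
by apply/funext => k; rewrite /slice pickleK.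
Qed.

(** Otherwise there are [c n], agreeing with [a] below [n], such that
    [P n (c n)] holds. At each coordinate [k] only [c 0], ..., [c k] can differ
    from [a], so the [c n] have a common upper bound [b], and [b] satisfies
    every [P n]. *)
Lemma cylinder_avoid (P : nat -> baire -> Prop) :
  (forall n a b, (a <= b)%O -> P n a -> P n b) ->
  (forall b, exists n, ~ P n b) ->
  forall a, exists n, forall b, mkseq b n = mkseq a n -> ~ P n b.
Proof.
move=> Pmono noP a; apply: contrapT => noN.
have /choice[c cP] n : exists b, mkseq b n = mkseq a n /\ P n b.
  apply: contrapT => nb; apply: noN; exists n => b ba Pb.
  by apply: nb; exists b.
pose b k := (a k + \sum_(n < k.+1) c n k)%N.
have [n] := noP b; apply; have [cn Pc] := cP n.
apply: Pmono Pc; apply/lefP => k; rewrite leEnat /b.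
have [kn|nk] := ltnP k n.
  rewrite -(nth_mkseq 0%N (c n) kn) cn nth_mkseq //; exact: leq_addr.
by rewrite (bigD1 (Ordinal (nk : (n < k.+1)%N))) //= addnCA leq_addr.
Qed.

(** * Bases of neighborhood assignments *)

Definition nbhd_assignment_base (X : topologicalType)
    (V : baire -> X -> set X) : Prop :=
  [/\ forall a x, nbhs x (V a x),
      forall a b, (a <= b)%O -> forall x, V b x `<=` V a x &
      forall N : X -> set X, (forall x, nbhs x (N x)) ->
        exists a, forall x, V a x `<=` N x].

Lemma universal_baire_baseP (X : topologicalType) :
  has_baire_base (universal_preuniformity X) <->
  exists V, @nbhd_assignment_base X V.
Proof.
split=> [[U [Unb Uanti Ubase]]|[V [Vnb Vanti Vbase]]].
  exists (fun a => xsection (U a)); split=> [a x|a b ab x y|N Nnb].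
  - exact: Unb.
  - by move=> /xsectionP Uy; apply/xsectionP; exact: Uanti ab _ Uy.
  - have [|a aN] := Ubase [set p | N p.1 p.2].
      by move=> x; rewrite xsectionE; exact: Nnb.
    by exists a => x y /xsectionP /aN.
exists (fun a => [set p | V a p.1 p.2]); split=> [a x|a b ab [x y]|W Wnb].
- by rewrite xsectionE; exact: Vnb.
- exact: Vanti.
- have [a aW] := Vbase (xsection W) Wnb.
  by exists a => -[x y] /= /aW /xsectionP.
Qed.

(** * Necessity *)

Lemma non_P_witness (X : topologicalType) (x : X) : ~ P_point x ->
  exists F : nat -> set X,
    (forall n, nbhs x (F n)) /\ ~ nbhs x (\bigcap_n F n).
Proof.
move=> nP; apply: contrapT => noF; apply: nP => G /countable_injP[e einj] Gx.
have /choice[F FP] n : exists W, nbhs x W /\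
    forall W', G W' -> e W' = n -> W = W'.
  have [[W [GW eW]]|nW] := pselect (exists W, G W /\ e W = n).
    exists W; split; first exact: Gx.
    by move=> W' GW' eW'; apply: einj; rewrite ?inE // eW.
  (* Numbers that code no member of [G] receive the whole space, which leaves
     the intersection unchanged. *)
  exists setT; split; first exact: filterT.
  by move=> W' GW' eW'; case: nW; exists W'.
apply: contrapT => nG; apply: noF; exists F.
split=> [n|]; first by case: (FP n).
apply: contra_not nG; apply: filterS => y Fy W GW.
by rewrite -((FP (e W)).2 W GW erefl); exact: Fy.
Qed.

Section necessity.
Context (X : topologicalType) (V : baire -> X -> set X).
Hypothesis VP : nbhd_assignment_base X V.

Lemma baire_base_at_points : space_has_baire_base X.
Proof.
case: VP => Vnb Vanti Vbase x; exists (V^~ x); split=> [a|a b ab|W Wx].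
- exact: Vnb.
- exact: Vanti.
- have [|a aW] := Vbase (fun y => [set z | y = x -> W z]).
    move=> y; have [->|yx] := pselect (y = x).
      by apply: filterS Wx => z Wz _.
    by apply: filterS filterT => z _ /yx.
  by exists a => z /aW; apply.
Qed.

(** Diagonalization along an injection [h] of [frak_d] into the non-singular
    points: [N (h u)] is chosen so as not to contain [V u (h u)]. *)
Lemma frak_d_nle_nonsingular : ~ (frak_d #<= nonsingular X).
Proof.
case: VP => Vnb Vanti Vbase.
move=> /card_leP[h].
have /choice[N NP] x : exists W, nbhs x W /\
    forall u : frak_d, set_val (h u) = x -> ~ V (set_val u) x `<=` W.
  have [[u hu]|nu] := pselect (exists u : frak_d, set_val (h u) = x).
    have xns : nonsingular X x by rewrite -hu; exact/set_mem/valP.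
    have [W [Wx nVW]] : exists W, nbhs x W /\ ~ V (set_val u) x `<=` W.
      apply: contrapT => noW; apply: xns.
      apply: filterS (Vnb (set_val u) x) => y Vy W Wx.
      by apply: contrapT => nWy; apply: noW; exists W; split=> // /(_ _ Vy).
    exists W; split=> // v hv; suff -> : v = u by [].
    by apply: (@inj _ _ _ h); rewrite ?inE //; apply: val_inj; rewrite [LHS]hv.
  by exists setT; split=> [|u hu]; [exact: filterT | case: nu; exists u].
have [a aN] := Vbase N (fun x => (NP x).1).
have [b /mem_set bd ab] := frak_dP.1 a.
apply: ((NP _).2 (exist _ b bd) erefl) => y Vy.
exact/aN/(Vanti _ _ ab).
Qed.


(** The points [f s] and the values [F (f s) (size s)] form a countable test
    that defeats every index [a]: some initial segment [s] of [a] has an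
    infinite [B s], and [a] itself extends [s]. *)
Lemma countable_non_P_points : countable (non_P_points X).
Proof.
case: VP => Vnb Vanti Vbase; apply: contrapT => uncountable_nP.
have /choice[F FP] x : exists F : nat -> set X, (forall n, nbhs x (F n)) /\
    (~ P_point x -> ~ nbhs x (\bigcap_n F n)).
  have [Px|/non_P_witness[F [FP nF]]] := pselect (P_point x); last by exists F.
  by exists (fun=> setT); split=> // n; exact: filterT.
pose B (s : seq nat) := [set x | ~ P_point x /\
  forall b, mkseq b (size s) = s -> ~ V b x `<=` F x (size s)].
have uncountable_B a : exists n, ~ countable (B (mkseq a n)).
  apply: contrapT => noN; apply: uncountable_nP.
  apply: (@sub_countable _ _ _ (\bigcup_n B (mkseq a n))); last first.
    apply: bigcup_countable => // n _.
    by apply: contrapT => nB; apply: noN; exists n.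
  apply: subset_card_le => x nPx.
  have [||n nVF] := @cylinder_avoid (fun n b => V b x `<=` F x n) _ _ a.
  - by move=> n b c bc; apply: subset_trans; exact: Vanti.
  - move=> b; apply: contrapT => VF; apply: (FP x).2 => //.
    apply: filterS (Vnb b x) => y Vy n _; apply: contrapT => nFy.
    by apply: VF; exists n => /(_ _ Vy).
  - by exists n => //; split=> //; rewrite size_mkseq.
pose I := {s : seq nat | `[< infinite_set (B s) >]}.
have [f finj fB] := @distinct_representatives I X (fun s => B (val s))
  (fun s => asboolW (valP s)).
have /choice[N NP] x : exists W, nbhs x W /\
    forall s : I, f s = x -> W = F x (size (val s)).
  have [[s fs]|ns] := pselect (exists s, f s = x).
    exists (F x (size (val s))); split; first exact: (FP x).1.
    by move=> t; rewrite -fs => /finj ->.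
  by exists setT; split=> [|s fs]; [exact: filterT | case: ns; exists s].
have [a aN] := Vbase N (fun x => (NP x).1).
have [n nB] := uncountable_B a.
have iB : `[< infinite_set (B (mkseq a n)) >].
  by apply/asboolP; apply: contra_not nB; exact: finite_set_countable.
pose s : I := exist _ (mkseq a n) iB.
have [_ /(_ a)] := fB s; rewrite /= size_mkseq => /(_ erefl); apply.
by apply: subset_trans (aN _) _; rewrite ((NP _).2 s erefl) /= size_mkseq.
Qed.

End necessity.

(** * Sufficiency *)

(** Replace [V a] by the intersection of the [V (a + k)] over all constants
    [k], a neighborhood since [x] is a P-point. If [a] is eventually dominated
    by [b], then [a <= b + K] for some [K], so that [V (b + (K + k))] is
    contained in [V (a + k)]. *)
Lemma P_point_star_base (X : topologicalType) (x : X) :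
  P_point x -> has_baire_base (nbhs x) ->
  exists V : baire -> set X,
    [/\ forall a, nbhs x (V a),
        forall a b, le_star a b -> V b `<=` V a &
        forall W, nbhs x W -> exists a, V a `<=` W].
Proof.
move=> Px [V [Vnb Vanti Vbase]].
pose shift k a : baire := fun n => (a n + k)%N.
exists (fun a => \bigcap_k V (shift k a)); split=> [a|a b ab y Vy k _|W Wx].
- apply: filterS (Px (range (fun k => V (shift k a))) _ _) => [y Vy k _||].
  + by apply: Vy; exists k.
  + exact: card_le_trans (card_image_le _ _) _.
  + by move=> _ [k _ <-]; exact: Vnb.
- have [K /lefP abK] := le_star_shift _ _ ab.
  apply: (Vanti _ (shift (K + k)%N b)); last exact: Vy.
  apply/lefP => n; rewrite leEnat /shift addnA leq_add2r; exact: abK.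
- have [a aW] := Vbase W Wx; exists a => y /(_ 0%N I) Vy; apply: aW.
  by apply: Vanti Vy; apply/lefP => n; rewrite /shift addn0.
Qed.

(** Slice [0] of the index is shared by all the non-singular P-points, and slice
    [(e x).+1] is reserved for the non-P-point [x] numbered [e x]. Singular
    points, whose number is arbitrary, are P-points too, but they ignore the
    index: fewer than [frak_b] demands are then left to dominate. *)
Lemma nbhd_assignment_base_exists (X : topologicalType) :
  space_has_baire_base X -> card_lt (nonsingular X) frak_b ->
  countable (non_P_points X) -> exists V, @nbhd_assignment_base X V.
Proof.
move=> /choice[V VP] ltb /countable_injP[e einj].
have /choice[S SP] x : exists S : baire -> set X, P_point x ->
    [/\ forall a, nbhs x (S a),
        forall a b, le_star a b -> S b `<=` S a &
        forall W, nbhs x W -> exists a, S a `<=` W].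
  have [Px|nPx] := pselect (P_point x); last by exists (fun=> setT) => /nPx.
  by have [S ?] := P_point_star_base _ x Px (ex_intro _ (V x) (VP x)); exists S.
pose N a x := if pselect (singular_point x) then \bigcap_(W in nbhs x) W
  else if pselect (P_point x) then S x (slice a 0)
  else V x (slice a (e x).+1).
exists N; split=> [a x|a b ab x|W Wnb]; rewrite /N.
- case: pselect => // nsx; case: pselect => [Px|nPx].
    by have [Snb _ _] := SP x Px; exact: Snb.
  by have [Vnb _ _] := VP x; exact: Vnb.
- case: pselect => [sx|nsx]; first exact: subset_refl.
  case: pselect => [Px|nPx].
    case: (SP x Px) => _ Santi _; apply: Santi.
    by exists 0%N => // k _; exact: (lefP _ _ (slice_le _ _ 0 ab)).
  by case: (VP x) => _ Vanti _; apply: Vanti; exact: slice_le.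
have /choice[d dP] x : exists d, P_point x -> S x d `<=` W x.
  have [Px|nPx] := pselect (P_point x); last by exists (fun=> 0%N) => /nPx.
  by have [_ _ /(_ _ (Wnb x))[d ?]] := SP x Px; exists d.
have [g gP] := le_star_bounded _ _ d ltb.2.
have /choice[c cP] n : exists c, forall x, ~ P_point x -> e x = n ->
    V x c `<=` W x.
  have [[x [nPx ex]]|nx] := pselect (exists x, ~ P_point x /\ e x = n).
    have [_ _ /(_ _ (Wnb x))[c cW]] := VP x; exists c => y nPy ey.
    by have -> : y = x by apply: einj; rewrite ?inE // ey.
  by exists (fun=> 0%N) => x nPx ex; case: nx; exists x.
have [a aP] := slice_surj (fun n => if n is m.+1 then c m else g).
exists a => x; rewrite !aP.
case: pselect => [sx y|nsx]; first exact.
case: pselect => [Px|nPx]; last exact: cP.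
by have [_ Santi _] := SP x Px; apply: subset_trans (dP x Px); exact/Santi/gP.
Qed.

Theorem theorem6p6 (hbd : frak_b #= frak_d) (X : topologicalType) :
  has_baire_base (universal_preuniformity X) <->
  [/\ space_has_baire_base X,
      card_lt (nonsingular X) frak_b &
      countable (non_P_points X)].
Proof.
split=> [/universal_baire_baseP[V VP]|[Xbase ltb nPcount]]; last first.
  by apply/universal_baire_baseP; exact: nbhd_assignment_base_exists.
have ndX := frak_d_nle_nonsingular _ _ VP.
split; first exact: baire_base_at_points VP.
  split; last by rewrite (card_le_eql hbd).
  case: (card_le_total _ _ (nonsingular X) frak_b) => // bX.
  by case: ndX; rewrite -(card_le_eql hbd).
exact: countable_non_P_points VP.
Qed.
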